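(* Let $b_0$ denote the threshold bias for the connectivity game $\mathcal{C}(S_b,n)$. Then $0.1n\le b_0\le \frac{3n}{7}$.
   Context: $\mathcal{C}(S_b,n)$ is the following game on the edge set of $K_n$ ($n$ large): players alternate; on each turn Maker claims one unclaimed edge, and Breaker claims a set of at most $b$ unclaimed edges all incident to a common vertex (a subgraph of a star with $b$ leaves). The game ends when no unclaimed edges remain. Maker wins if her graph contains a spanning tree of $K_n$; otherwise Breaker wins. The threshold bias is the value $b_0(n)$ such that Breaker wins if $b>b_0$ and Maker wins if $b\le b_0$. Convention: when considering Maker strategies Breaker makes the first move, and when considering Breaker strategies Maker makes the first move. *)

(* Defs.v *)
From mathcomp Require Import all_boot.

Set Implicit Arguments.
Unset Strict Implicit.
Unset Printing Implicit Defensive.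

(* A graph on the vertex set 'I_n is given by its edge set, edges being       *)
(* two-element sets of vertices.                                              *)
Notation graph n := {set {set 'I_n}}.

Definition complete_graph (n : nat) : graph n := [set e : {set 'I_n} | #|e| == 2].

Section Trees.
Variable n : nat.
Implicit Types G T : graph n.

Definition adj G : rel 'I_n := fun u v => (u != v) && ([set u; v] \in G).

Definition connected_graph G : Prop := forall u v, connect (adj G) u v.

(* [ucycle] only asks for distinct vertices: the bound on the length excludes *)
(* the closed walk u, v, u along a single edge.                               *)
Definition acyclic_graph G : Prop :=
  forall c : seq 'I_n, 2 < size c -> ~ ucycle (adj G) c.

Definition spanning_tree T : Prop :=
  [/\ T \subset complete_graph n, connected_graph T & acyclic_graph T].

End Trees.

Variant player := Maker | Breaker.

Definition opponent (p : player) : player :=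
  match p with Maker => Breaker | Breaker => Maker end.

Record position (n : nat) := Position {
  turn : player;
  maker_graph : graph n;
  breaker_graph : graph n
}.

Definition start (n : nat) (first : player) : position n :=
  Position first set0 set0.

Section Game.
Variables n b : nat.
Implicit Types s t : position n.

Definition unclaimed s : graph n :=
  complete_graph n :\: (maker_graph s :|: breaker_graph s).

Definition game_over s : Prop := unclaimed s = set0.

Definition won_by (p : player) s : Prop :=
  let maker_goal := exists2 T : graph n, spanning_tree T & T \subset maker_graph s in
  match p with Maker => maker_goal | Breaker => ~ maker_goal end.

(* Breaker's set S may be empty, "at most b" being read literally.            *)
Variant legal_move : position n -> position n -> Prop :=
| MakerMove M B e :
    e \in unclaimed (Position Maker M B) ->
    legal_move (Position Maker M B) (Position Breaker (e |: M) B)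
| BreakerMove M B (S : graph n) (v : 'I_n) :
    ~ game_over (Position Breaker M B) ->
    S \subset unclaimed (Position Breaker M B) ->
    #|S| <= b ->
    (forall e, e \in S -> v \in e) ->
    legal_move (Position Breaker M B) (Position Maker M (S :|: B)).

(* Player p has a winning strategy from the given position. Every play is     *)
(* finite, since Maker claims an edge at each of her turns.                   *)
Inductive wins (p : player) : position n -> Prop :=
| WinsOver s : game_over s -> won_by p s -> wins p s
| WinsOwnTurn s t : turn s = p -> legal_move s t -> wins p t -> wins p s
| WinsOppTurn s :
    turn s = opponent p -> ~ game_over s ->
    (forall t, legal_move s t -> wins p t) -> wins p s.

End Game.

(* The order of play is a parameter: the custom of letting the opponent of    *)
(* the player under consideration start amounts to treating both values of    *)
(* [first], since moving first is never a disadvantage.                       *)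
Definition threshold_bias (n : nat) (first : player) (b0 : nat) : Prop :=
  forall b : nat,
    (b0 < b -> wins b Breaker (start n first)) /\
    (b <= b0 -> wins b Maker (start n first)).

(* Main.v *)
(* Maker's side: she keeps one active vertex in each component of her graph and
   always moves from the active vertex [w] of largest Breaker-degree among the
   small components (fewer than n/6 vertices), joining it to another component;
   [w] is then retired. A star raises the degree of each vertex but its centre by at
   most 1, so when the maximal active degree reaches m, the retired vertices have
   degree sum at least 1 + ... + m; since Breaker claims at most bn edges, this
   gives m(m+1) <= 4bn, so m + b < 5n/6 and [w] can always leave its component.
   Components with at least n/6 vertices cannot be cut off, as that would take
   more than bn edges.

   Breaker's side: he keeps a set W of vertices untouched by Maker and with no
   claimed edge inside. Each round costs at most two vertices of W (the centre of
   the star is chosen among the vertices that Maker touches, if possible), and raises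
   the degree of b of the remaining ones. In two stages, each raising all degrees by
   about n/14, W shrinks from n to about 2n/3 and then 4n/9 > b. From then on every
   star centred in W is a threat to isolate its centre u and covers all edges from u
   to W, so Maker's forced reply removes only u from W, while all the other degrees
   grow; the last vertex of W is isolated. *)
Require Import Defs.
From mathcomp Require Import all_boot all_order all_algebra zify.
From Stdlib Require Import Classical.

Set Implicit Arguments.
Unset Strict Implicit.
Unset Printing Implicit Defensive.

Lemma exists_set_between (T : finType) (A C : {set T}) k :
  A \subset C -> #|A| <= k <= #|C| ->
  exists Q : {set T}, [/\ A \subset Q, Q \subset C & #|Q| = k].
Proof.
move=> sAC /andP[leAk lekC].
have /card_gt0P[D] :
    0 < #|[set D : {set T} | D \subset C :\: A & #|D| == k - #|A|]|.
  by rewrite cards_draws bin_gt0 cardsDS // leq_sub2r.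
rewrite inE subsetD => /andP[/andP[sDC disDA] /eqP cardD].
exists (A :|: D); split; first exact: subsetUl.
  by rewrite subUset sAC.
by apply/eqP; rewrite cardsU setIC disjoint_setI0 // cards0 cardD subn0 subnKC.
Qed.

Lemma exists_setDU1_card (T : finType) (W E : {set T}) : 0 < #|W| -> 0 < #|E| ->
  exists2 c, c \in W & #|W| <= #|W :\: (c |: E)| + #|E|.
Proof.
move=> W_gt0 E_gt0.
suff [c cW le_E] : exists2 c, c \in W & #|W :&: (c |: E)| <= #|E|.
  by exists c => //; rewrite -(cardsID (c |: E) W) addnC leq_add2l.
have [/pred0P dis|/pred0Pn[c /= /andP[cW cE]]] := boolP [disjoint W & E].
  have /card_gt0P[c cW] := W_gt0; exists c => //.
  apply: leq_trans E_gt0; rewrite -(cards1 c).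
  apply/subset_leq_card/subsetP=> v /setIP[vW /setU1P[->|vE]]; rewrite inE //.
  by have := dis v; rewrite /= vW vE.
exists c => //; apply/subset_leq_card/subsetP=> v.
by case/setIP=> _ /setU1P[->|].
Qed.

(* The elements of [P] are one unit ahead of the rest of [W]. After one more unit
   goes to [b] of the poorest, [P'] is ahead; [t] tells if the base level has risen. *)
Lemma near_level_feed (T : finType) (W P : {set T}) b : P \subset W -> b <= #|W| ->
  exists (Q P' : {set T}) (t : bool),
    [/\ Q \subset W, #|Q| = b, P' \subset W,
        forall v, v \in W -> t + (v \in P') <= (v \in P) + (v \in Q)
      & #|P'| + t * #|W| = #|P| + b].
Proof.
move=> sPW leb; have cardWP : #|W :\: P| = #|W| - #|P| by rewrite cardsDS.
have leP := subset_leq_card sPW; have [le_poor|lt_poor] := leqP b #|W :\: P|.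
  have [|Q [_ sQ cardQ]] := exists_set_between (sub0set (W :\: P)) (k := b).
    by rewrite cards0.
  have [sQW disQ] : Q \subset W /\ [disjoint Q & P] by apply/andP; rewrite -subsetD.
  exists Q, (P :|: Q), false; split=> //; first by rewrite subUset sPW.
    by move=> v _; rewrite inE; case: (v \in P); case: (v \in Q).
  by rewrite cardsU setIC disjoint_setI0 // cards0 subn0 addn0 cardQ.
have [|Q [poorQ sQW cardQ]] := exists_set_between (subsetDl W P) (k := b).
  by rewrite ltnW.
exists Q, (P :&: Q), true; split=> //; first by rewrite subIset ?sPW.
  move=> v vW; have := subsetP poorQ v; rewrite !inE vW andbT.
  by case: (v \in P); case: (v \in Q) => //= /(_ isT).
have -> : W = P :|: Q.
  apply/eqP; rewrite eqEsubset subUset sPW sQW -{1}(setID W P).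
  by rewrite setUSS // subsetIr.
rewrite mul1n addnC -cardQ cardsU subnK //.
by apply: leq_trans (leq_addr _ _); rewrite subset_leq_card ?subsetIl.
Qed.

Lemma near_level_sub (T : finType) (W W' P : {set T}) k m :
  W' \subset W -> P \subset W -> 0 < k ->
  #|W| * k <= #|P| + m -> #|W'| * k <= #|P :&: W'| + m.
Proof.
move=> sW' sPW k_gt0 missing; have leW' := subset_leq_card sW'.
have lost : #|P| + #|W'| <= #|P :&: W'| + #|W|.
  have := cardsID W' P; have := subset_leq_card (setSD W' sPW).
  by rewrite (cardsDS sW'); lia.
have : #|W| - #|W'| <= #|W| * k - #|W'| * k by rewrite -mulnBl leq_pmulr.
have : #|W'| * k <= #|W| * k by rewrite leq_mul2r leW' orbT.
by lia.
Qed.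

Lemma near_level_reached (T : finType) (W P : {set T}) h l v :
  P \subset W -> v \in W -> #|W| * (h - l) <= #|P| -> h <= l + (v \in P).
Proof.
move=> sPW vW full; have [hl|lh] := leqP h l.
  exact: leq_trans (leq_addr _ _).
have leP := subset_leq_card sPW.
have W_gt0 : 0 < #|W| by apply/card_gt0P; exists v.
have le1 : h - l <= 1 by rewrite -(leq_pmul2l W_gt0) muln1 (leq_trans full).
have hl1 : h = l.+1 by lia.
have -> : P = W by apply/eqP; rewrite eqEcard sPW -[#|W|]muln1 -(subSnn l) -hl1.
by rewrite vW addn1 hl1.
Qed.

Definition edges_at n (G : graph n) (v : 'I_n) : graph n :=
  [set e in G | v \in e].

Definition deg n (G : graph n) (v : 'I_n) : nat := #|edges_at G v|.

Definition star n (S : graph n) (c : 'I_n) : Prop := forall e, e \in S -> c \in e.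

Definition spokes n (c : 'I_n) (Q : {set 'I_n}) : graph n :=
  [set [set c; q] | q in Q].

Section Graphs.
Variable n : nat.
Implicit Types (G S T : graph n) (u v w c : 'I_n) (e Q : {set 'I_n}).

Lemma edge_complete u v : u != v -> [set u; v] \in complete_graph n.
Proof. by move=> uv; rewrite inE cards2 uv. Qed.

Lemma edgeE e u v :
  e \in complete_graph n -> u \in e -> v \in e -> u != v -> e = [set u; v].
Proof.
rewrite inE => /eqP e2 ue ve uv; apply/esym/eqP.
by rewrite eqEcard subUset !sub1set ue ve e2 cards2 uv.
Qed.

Lemma edge_injr u : injective (fun v => [set u; v]).
Proof.
move=> v w /setP E; have := E v; have := E w; rewrite !inE !eqxx !orbT.
by have [->|wu] /= := eqVneq w u; [rewrite orbb => _ /esym/eqP | move=> /eqP].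
Qed.

Lemma card_spokes c Q : #|spokes c Q| = #|Q|.
Proof. exact/card_imset/edge_injr. Qed.

Lemma star_spokes c Q : star (spokes c Q) c.
Proof. by move=> _ /imsetP[q _ ->]; apply: set21. Qed.

Lemma edges_at_sub G v : edges_at G v \subset G.
Proof. by rewrite /edges_at setIdE subsetIl. Qed.

Lemma degS G G' v : G \subset G' -> deg G v <= deg G' v.
Proof. by move=> sG; rewrite /deg /edges_at !setIdE subset_leq_card ?setSI. Qed.

Lemma edges_atU G G' v : edges_at (G :|: G') v = edges_at G v :|: edges_at G' v.
Proof. by rewrite /edges_at setIdE setIUl -!setIdE. Qed.

Lemma degU G G' v : deg (G :|: G') v <= deg G v + deg G' v.
Proof. by rewrite /deg edges_atU leq_card_setU. Qed.

Lemma degU_disjoint G G' v : [disjoint G & G'] ->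
  deg (G :|: G') v = deg G v + deg G' v.
Proof.
move=> dis; apply/eqP; rewrite /deg edges_atU (leq_card_setU _ _).2.
by apply: disjointW dis; apply: edges_at_sub.
Qed.

Lemma deg_le_card G v : deg G v <= #|G|.
Proof. exact/subset_leq_card/edges_at_sub. Qed.

Lemma deg_centre S c : star S c -> deg S c = #|S|.
Proof.
move=> Sc; apply: eq_card => e; rewrite inE.
by case eS: (e \in S) => //=; apply: Sc.
Qed.

Lemma deg_leaf S c v :
  S \subset complete_graph n -> star S c -> v != c -> deg S v <= 1.
Proof.
move=> sS Sc vc; rewrite -(cards1 [set v; c]); apply/subset_leq_card/subsetP=> e.
rewrite !inE => /andP[eS ve]; apply/eqP.
by apply: edgeE => //; [apply: (subsetP sS) | apply: Sc].
Qed.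

Lemma deg_complete v : deg (complete_graph n) v <= n.-1.
Proof.
rewrite -[n in n.-1]card_ord -(cardsC1 v) -(card_spokes v).
apply/subset_leq_card/subsetP=> e; rewrite inE => /andP[eK ve]; apply/imsetP.
have /card_gt0P[u] : 0 < #|e :\ v|.
  by move: eK; rewrite inE (cardsD1 v e) ve add1n eqSS => /eqP->.
rewrite !inE => /andP[uv ue]; exists u; first by rewrite !inE.
by apply: edgeE => //; rewrite eq_sym.
Qed.

Lemma sum_deg G : G \subset complete_graph n -> \sum_v deg G v = 2 * #|G|.
Proof.
move=> sG.
under eq_bigr => v _ do rewrite /deg /edges_at -sum1dep_card big_mkcondr.
rewrite exchange_big mulnC -sum_nat_const; apply: eq_bigr => e eG /=.
by have := subsetP sG _ eG; rewrite inE -big_mkcond sum1_card => /eqP.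
Qed.

Lemma connect_adjC G u v : connect (adj G) u v = connect (adj G) v u.
Proof. by apply: sym_connect_sym => x y; rewrite /adj eq_sym setUC. Qed.

Lemma connect_edge G u v : [set u; v] \in G -> connect (adj G) u v.
Proof.
move=> uvG; have [->|uv] := eqVneq u v; first exact: connect0.
by apply: connect1; rewrite /adj uv.
Qed.

Lemma connect_adjS G G' u v :
  G \subset G' -> connect (adj G) u v -> connect (adj G') u v.
Proof.
move=> sG; apply: connect_sub => x y /andP[xy eG]; apply: connect1.
by rewrite /adj xy (subsetP sG).
Qed.

Lemma connected_graphD1 G u v : connect (adj (G :\ [set u; v])) u v ->
  connected_graph G -> connected_graph (G :\ [set u; v]).
Proof.
move=> uv conn x y; apply: connect_sub (conn x y) => a c /andP[ac acG].
have [E|neq] := eqVneq [set a; c] [set u; v]; last first.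
  by apply: connect1; rewrite /adj ac !inE neq.
have: a \in [set u; v] by rewrite -E set21.
have: c \in [set u; v] by rewrite -E set22.
by rewrite !inE => /orP[]/eqP-> /orP[]/eqP->; rewrite // connect_adjC.
Qed.

Lemma ucycle_bypass G u v p : 0 < size p -> ucycle (adj G) [:: u, v & p] ->
  connect (adj (G :\ [set u; v])) u v.
Proof.
case: p => // w p _ /andP[/= /and3P[_ /andP[vw vwG] path_p]].
rewrite !inE !negb_or -!andbA => /and5P[uv uw up _ /andP[vp _]].
have avoid_v : {in predC1 v &, subrel (adj G) (adj (G :\ [set u; v]))}.
  move=> a c; rewrite !inE => av cv /andP[ac acG]; rewrite /adj ac !inE acG andbT.
  apply/eqP=> /setP/(_ v); rewrite !inE eqxx orbT eq_sym (negPf av).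
  by rewrite eq_sym (negPf cv).
rewrite connect_adjC; apply: (@connect_trans _ _ w).
  apply: connect1; rewrite /adj vw !inE vwG andbT.
  apply: contraNneq uw => /setP/(_ u).
  by rewrite !inE eqxx (negPf uv) /= => ->.
apply: (path_connect (sub_in_path avoid_v _ path_p)); last first.
  by rewrite inE mem_rcons mem_head orbT.
rewrite /= eq_sym vw all_rcons inE uv /=; apply/allP=> a ap.
by rewrite inE; apply: contraNneq vp => <-.
Qed.

Lemma connected_spanning_tree G : G \subset complete_graph n ->
  connected_graph G -> exists2 T, spanning_tree T & T \subset G.
Proof.
pose conn T := [forall u, forall v, connect (adj T) u v].
have connP T : reflect (connected_graph T) (conn T).
  by apply: (iffP forallP) => conn_all u; move/forallP: (conn_all u).
move=> sG /connP connG; have [T minT sTG] := minset_exists connG.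
exists T => //; have connT := connP _ (minsetp minT).
split=> // [|[//|u [//|v p]] size_p cycle_p]; first exact: subset_trans sG.
have /connP connTD := connected_graphD1 (ucycle_bypass size_p cycle_p) connT.
have : [set u; v] \in T by case/andP: cycle_p => /= /andP[/andP[]].
by rewrite -(minsetinf minT connTD (subsetDl _ _)) !inE eqxx.
Qed.

End Graphs.

Definition free_edges n (M B : graph n) : graph n :=
  complete_graph n :\: (M :|: B).

Lemma free_edgesS n (M B M' B' : graph n) :
  M \subset M' -> B \subset B' -> free_edges M' B' \subset free_edges M B.
Proof. by move=> sM sB; apply/setDS/setUSS. Qed.

Lemma free_edges_disjoint n (M B : graph n) : [disjoint free_edges M B & B].
Proof.
by apply/pred0P=> e /=; rewrite !inE; case: (e \in B); rewrite ?orbT ?andbF.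
Qed.

Lemma card_free_edge n (M B : graph n) e : e \in free_edges M B -> #|e| = 2.
Proof. by case/setDP; rewrite inE => /eqP. Qed.

Lemma deg_free_edges n (M B : graph n) v : B \subset complete_graph n ->
  deg (free_edges M B) v + deg B v <= n.-1.
Proof.
move=> sB; rewrite -degU_disjoint.
  apply: leq_trans (deg_complete v); apply: degS.
  by rewrite subUset sB subsetDl.
exact: (@free_edges_disjoint _ M).
Qed.

Section GameTheory.
Variables n b : nat.
Implicit Types (s t : position n) (p : player) (M B : graph n).

Lemma legal_Maker_move M B t : legal_move b (Position Maker M B) t ->
  exists2 e, e \in free_edges M B & t = Position Breaker (e |: M) B.
Proof.
move E : (Position _ _ _) => s st.
by case: st E => // M' B' e eF [-> ->]; exists e.
Qed.

Lemma legal_Breaker_move M B t : legal_move b (Position Breaker M B) t ->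
  exists (S : graph n) c, [/\ S \subset free_edges M B, #|S| <= b, star S c
                            & t = Position Maker M (S :|: B)].
Proof.
move E : (Position _ _ _) => s st.
by case: st E => // M' B' S c _ sS leS Sc [-> ->]; exists S, c.
Qed.

Lemma game_over_em s : game_over s \/ ~ game_over s.
Proof. by case: (unclaimed s =P set0); [left | right]. Qed.

Lemma legal_move_not_over s t : legal_move b s t -> ~ game_over s.
Proof. by case=> // M B e eF over; rewrite over inE in eF. Qed.

Lemma pass_legal M B : ~ game_over (Position Breaker M B) ->
  legal_move b (Position Breaker M B) (Position Maker M B).
Proof.
move=> no; have /set0Pn[e] : unclaimed (Position Breaker M B) != set0 by apply/eqP.
move/card_free_edge=> e2; have /card_gt0P[c _] : 0 < #|e| by rewrite e2.
rewrite -{2}[B]set0U; apply: (BreakerMove (v := c) no); rewrite ?sub0set ?cards0 //.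
by move=> f; rewrite inE.
Qed.

Lemma legal_move_exists s : ~ game_over s -> exists t, legal_move b s t.
Proof.
case: s => [[] M B] no; last by exists (Position Maker M B); apply: pass_legal.
have /set0Pn[e eF] : unclaimed (Position Maker M B) != set0 by apply/eqP.
by exists (Position Breaker (e |: M) B); constructor.
Qed.

(* The second summand is there because Breaker may pass. *)
Definition moves_left s : nat :=
  2 * #|unclaimed s| + (if turn s is Breaker then 1 else 0).

Lemma legal_move_left s t : legal_move b s t -> moves_left t < moves_left s.
Proof.
case=> [M B e eF | M B S c _ _ _ _]; rewrite /moves_left /=.
- suff: #|free_edges (e |: M) B| < #|free_edges M B|.
    by rewrite /unclaimed /free_edges /=; lia.
  apply/proper_card/properP; split; first by rewrite free_edgesS ?subsetUr.
  by exists e; rewrite // !inE eqxx.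
- suff: #|free_edges M (S :|: B)| <= #|free_edges M B|.
    by rewrite /unclaimed /free_edges /=; lia.
  by rewrite subset_leq_card ?free_edgesS ?subsetUr.
Qed.

Lemma legal_move_ind (P : position n -> Prop) :
  (forall s, (forall t, legal_move b s t -> P t) -> P s) -> forall s, P s.
Proof.
move=> IH s; have [k] := ubnP (moves_left s); elim: k s => // k IHk s lt_s.
by apply: IH => t /legal_move_left lt_t; apply: IHk; lia.
Qed.

Lemma opponentK : involutive opponent.
Proof. by case. Qed.

Lemma player_or_opponent p q : q = p \/ q = opponent p.
Proof. by case: p q => [] []; [left | right | right | left]. Qed.

Lemma wins_strategy p (P : position n -> Prop) :
  (forall s, P s -> game_over s -> won_by p s) ->
  (forall s, P s -> turn s = p -> ~ game_over s ->
     wins b p s \/ exists2 t, legal_move b s t & P t) ->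
  (forall s t, P s -> turn s = opponent p -> legal_move b s t -> P t) ->
  forall s, P s -> wins b p s.
Proof.
move=> over_won own_move opp_move; elim/legal_move_ind => s IH Ps.
have [over|no] := game_over_em s; first by apply: WinsOver => //; apply: over_won.
have [tp|to] := player_or_opponent p (turn s).
- have [//|[t st Pt]] := own_move s Ps tp no.
  by apply: (WinsOwnTurn tp st); apply: IH.
- by apply: WinsOppTurn => // t st; apply: IH => //; apply: opp_move st.
Qed.

Lemma wins_invariant p (P : position n -> Prop) :
  (forall s t, P s -> legal_move b s t -> P t) ->
  (forall s, P s -> won_by p s) -> forall s, P s -> wins b p s.
Proof.
move=> move_P P_won; apply: wins_strategy => [s Ps _|s Ps _ no|s t Ps _].
- exact: P_won.
- have [t st] := legal_move_exists no.
  by right; exists t => //; apply: move_P st.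
- exact: move_P.
Qed.

Lemma wins_determined p s : wins b p s \/ wins b (opponent p) s.
Proof.
elim/legal_move_ind: s p => s IH p.
have [over|no] := game_over_em s.
  have [won|lost] := classic (won_by p s); first by left; apply: WinsOver.
  by right; apply: WinsOver => //; case: p lost => //; apply: NNPP.
wlog tp : p / turn s = p.
  move=> wl; have [|to] := player_or_opponent p (turn s); first exact: wl.
  by have := wl _ to; rewrite opponentK; tauto.
have [[t st wt]|nw] := classic (exists2 t, legal_move b s t & wins b p t).
  by left; apply: (WinsOwnTurn tp st).
right; apply: WinsOppTurn; rewrite ?opponentK // => t st.
by case: (IH t st p) => // wt; case: nw; exists t.
Qed.

Lemma wins_over p s : game_over s -> wins b p s -> won_by p s.
Proof.
by move=> over W; case: W over => // {}s t _ st _ /(legal_move_not_over st).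
Qed.

Lemma wins_own_turn p s : turn s = p -> ~ game_over s -> wins b p s ->
  exists2 t, legal_move b s t & wins b p t.
Proof.
move=> tp no W; case: W tp no => // {}s; first by move=> t _ st wt _ _; exists t.
by move=> -> _ _ /esym; case: p.
Qed.

Lemma wins_opponent_turn p s t :
  turn s = opponent p -> legal_move b s t -> wins b p s -> wins b p t.
Proof.
move=> to st W; case: W to st => {}s.
- by move=> over _ _ st; case: (legal_move_not_over st).
- by move=> t' -> _ _; case: p.
- by move=> _ _ win_t _; apply: win_t.
Qed.

Lemma wins_exclusive p s : wins b p s -> ~ wins b (opponent p) s.
Proof.
elim/legal_move_ind: s p => s IH p winp wino.
have [over|no] := game_over_em s.
  by move: (wins_over over winp) (wins_over over wino); case: (p).
wlog tp : p winp wino / turn s = p.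
  move=> wl; have [|to] := player_or_opponent p (turn s); first exact: wl.
  by apply: (wl (opponent p)); rewrite ?opponentK.
have [t st wt] := wins_own_turn tp no winp.
by apply: (IH t st p wt); apply: wins_opponent_turn st wino; rewrite opponentK.
Qed.

Lemma Breaker_wins_pass M B : wins b Breaker (Position Maker M B) ->
  wins b Breaker (Position Breaker M B).
Proof.
move=> win; have [over|no] := game_over_em (Position Breaker M B).
  by apply: WinsOver => //; have := @wins_over _ (Position Maker M B) over win.
by apply: WinsOwnTurn (pass_legal no) win.
Qed.

End GameTheory.

Lemma wins_Breaker_mono n b b' (s : position n) :
  b <= b' -> wins b Breaker s -> wins b' Breaker s.
Proof.
move=> le_b; elim=> {s} [s over won | s t tp st _ IH | s to no _ IH].
- exact: WinsOver.
- apply: (WinsOwnTurn tp _ IH).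
  case: st tp => // M B S c no sS leS Sc _.
  by apply: (BreakerMove no sS _ Sc); apply: leq_trans le_b.
- apply: WinsOppTurn => // t st; apply: IH.
  by case: st to => // M B e eF _; constructor.
Qed.

Lemma wins_Maker_antimono n b b' (s : position n) :
  b' <= b -> wins b Maker s -> wins b' Maker s.
Proof.
move=> le_b winM; case: (wins_determined b' Maker s) => // winB.
by case: (wins_exclusive winM); apply: wins_Breaker_mono winB.
Qed.

Lemma threshold_bias_exists n first k :
  wins 0 Maker (start n first) -> wins k Breaker (start n first) ->
  exists b0, threshold_bias n first b0.
Proof.
move=> win0; elim: k => [winB|k IH winB]; first by case: (wins_exclusive win0).
have [winM|] := wins_determined k Maker (start n first); last exact: IH.
exists k => b; split=> lt_b; first exact: wins_Breaker_mono lt_b winB.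
exact: wins_Maker_antimono lt_b winM.
Qed.

Lemma threshold_bias_ge n first b0 b :
  wins b Maker (start n first) -> threshold_bias n first b0 -> b <= b0.
Proof.
move=> winM thr; rewrite leqNgt; apply/negP => /(thr b).1.
exact: wins_exclusive winM.
Qed.

Lemma threshold_bias_lt n first b0 b :
  wins b Breaker (start n first) -> threshold_bias n first b0 -> b0 < b.
Proof.
move=> winB thr; rewrite ltnNge; apply/negP => /(thr b).2.
exact: wins_exclusive winB.
Qed.

Section Components.
Variable n : nat.
Implicit Types (M B : graph n) (u v w x y : 'I_n) (A C : {set 'I_n}).

Definition component M w : {set 'I_n} := [set x | connect (adj M) w x].

Lemma mem_component M w : w \in component M w.
Proof. by rewrite inE connect0. Qed.

Lemma componentS M M' w : M \subset M' -> component M w \subset component M' w.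
Proof. by move=> sM; apply/subsetP=> x; rewrite !inE; apply: connect_adjS. Qed.

Lemma card_two_components M w v :
  v \notin component M w -> #|component M w| + #|component M v| <= n.
Proof.
move=> wv; rewrite -[leqRHS]card_ord -(cardsC (component M w)) leq_add2l.
apply/subset_leq_card/subsetP=> x; rewrite !inE in wv * => vx.
by apply: contra wv => wx; apply: connect_trans wx _; rewrite connect_adjC.
Qed.

Lemma boundary_free M B w x y : x \in component M w -> y \notin component M w ->
  ([set x; y] \in free_edges M B) = ([set x; y] \notin B).
Proof.
rewrite !inE => wx wy; have xy : x != y by apply: contraNneq wy => <-.
rewrite cards2 xy andbT negb_or andb_idl // => _; apply: contra wy => xyM.
exact: connect_trans wx (connect_edge xyM).
Qed.

Lemma free_edge_at M B w : #|component M w| + deg B w < n ->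
  exists2 y, y \notin component M w & [set w; y] \in free_edges M B.
Proof.
move=> lt_n.
have /subsetPn[_ /imsetP[y yC ->] yB] :
    ~~ (spokes w (~: component M w) \subset edges_at B w).
  apply: contraTN lt_n => /subset_leq_card; rewrite card_spokes.
  by rewrite (cardsCs (~: _)) setCK card_ord leq_subLR -leqNgt.
rewrite inE in yC; exists y; rewrite // (boundary_free _ _ yC) ?mem_component //.
by apply: contra yB => yB; rewrite !inE yB eqxx.
Qed.

Lemma cut_edge_inj C :
  {in setX C (~: C) &, injective (fun p : 'I_n * 'I_n => [set p.1; p.2])}.
Proof.
move=> [x y] [x' y']; rewrite !inE /= => /andP[xC yC] /andP[xC' yC'] E.
have : x \in [set x'; y'] by rewrite -E set21.
have : y \in [set x'; y'] by rewrite -E set22.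
rewrite !inE => /orP[/eqP yx|/eqP->]; first by rewrite yx xC' in yC.
by case/orP=> /eqP xx; [rewrite xx | rewrite xx (negPf yC') in xC].
Qed.

Lemma free_edge_across M B w :
  #|B| < #|component M w| * (n - #|component M w|) ->
  exists x y, [/\ x \in component M w, y \notin component M w
                & [set x; y] \in free_edges M B].
Proof.
set C := component M w => lt_cut.
pose cut := [set [set p.1; p.2] | p in setX C (~: C)].
have /subsetPn[_ /imsetP[[x y] xyC ->] /= xyB] : ~~ (cut \subset B).
  apply: contraTN lt_cut => /subset_leq_card.
  rewrite (card_in_imset (@cut_edge_inj C)) cardsX (cardsCs (~: C)) setCK card_ord.
  by rewrite -leqNgt.
move: xyC; rewrite inE in_setC => /andP[/= xC yC].
by exists x, y; rewrite (@boundary_free _ _ w).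
Qed.

Definition represents M A : Prop :=
  forall x, exists2 a, a \in A & connect (adj M) a x.

Lemma represents_merge M A w x y :
  represents M A -> x \in component M w -> y \notin component M w ->
  represents ([set x; y] |: M) (A :\ w).
Proof.
rewrite !inE => rep wx wy z; set M' := _ |: M.
have sM : M \subset M' by apply: subsetUr.
have [a aA az] := rep z; have [aw|aw] := eqVneq a w; last first.
  by exists a; [rewrite !inE aw | apply: connect_adjS az].
have [a' aA' ay] := rep y; exists a'.
  by rewrite !inE aA' andbT; apply: contraNneq wy => <-.
have xy : connect (adj M') x y by apply/connect_edge/setU11.
rewrite aw in az; apply: connect_trans (connect_adjS sM ay) _.
rewrite connect_adjC in xy; apply: connect_trans xy (connect_adjS sM _).
by apply: connect_trans az; rewrite connect_adjC.
Qed.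

End Components.

Section MakerStrategy.
Variables n b small : nat.
Implicit Types (M B S : graph n) (w x y c : 'I_n) (A : {set 'I_n}).

Lemma connected_Maker_wins (s : position n) :
  maker_graph s \subset complete_graph n -> connected_graph (maker_graph s) ->
  wins b Maker s.
Proof.
move=> sM conn; pose P (s : position n) :=
  maker_graph s \subset complete_graph n /\ connected_graph (maker_graph s).
apply: (@wins_invariant n b Maker P) => // {s sM conn} [s t [sM conn] st|s []].
  case: st sM conn => //= M B e eF sM conn; split=> /= [|u v].
    by rewrite subUset sM andbT sub1set; case/setDP: eF.
  by apply: connect_adjS (conn u v); apply: subsetUr.
exact: connected_spanning_tree.
Qed.

Definition small_active M A : {set 'I_n} :=
  [set a in A | #|component M a| < small].

Lemma small_activeS M M' A A' : M \subset M' -> A' \subset A ->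
  small_active M' A' \subset small_active M A.
Proof.
move=> sM sA; apply/subsetP=> a; rewrite !inE => /andP[/(subsetP sA) -> lt_a].
by apply: leq_ltn_trans lt_a; rewrite subset_leq_card ?componentS.
Qed.

Definition retired_degree B A : nat := \sum_(u in ~: A) deg B u.

Lemma retired_degreeS B B' A :
  B \subset B' -> retired_degree B A <= retired_degree B' A.
Proof. by move=> sB; apply: leq_sum => u _; apply: degS. Qed.

Lemma retired_degreeD1 B A w : w \in A ->
  retired_degree B (A :\ w) = deg B w + retired_degree B A.
Proof.
move=> wA; rewrite /retired_degree (bigD1 w) ?inE ?eqxx //=; congr (_ + _).
apply: eq_bigl => u; rewrite !inE negb_and negbK.
by have [->|] := eqVneq u w; rewrite ?wA ?andbF ?andbT.
Qed.

Lemma retired_degree_le B A : B \subset complete_graph n ->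
  retired_degree B A <= 2 * #|B|.
Proof.
by move=> sB; rewrite -(sum_deg sB) [leqRHS](bigID (mem (~: A))) leq_addr.
Qed.

(* [A] holds the active vertices, and Breaker has moved [r - #|A|] times. The retired
   vertices had degrees at least [1, ..., m] when they were retired, and [f] bounds
   the degrees of the active vertices of small components. *)
Definition maker_inv r (f : 'I_n -> nat) m M B A : Prop :=
  [/\ M :|: B \subset complete_graph n, represents M A,
      #|B| + b * #|A| <= b * r,
      forall a, a \in small_active M A -> deg B a <= f a
    & m * m.+1 <= 2 * retired_degree B A].

Definition maker_before_star m := maker_inv n (fun=> m) m.

Definition maker_after_star c m := maker_inv n.+1 (fun a => m.+1 + (a == c) * b) m.

Lemma maker_inv_start : maker_before_star 0 set0 set0 setT.
Proof.
split; rewrite ?setU0 ?sub0set ?cards0 ?cardsT ?card_ord //.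
  by move=> x; exists x; rewrite ?inE ?connect0.
by move=> a _; rewrite leqn0 cards_eq0 -subset0 edges_at_sub.
Qed.

Lemma maker_inv_star M B A m S c : maker_before_star m M B A ->
  S \subset complete_graph n -> #|S| <= b -> star S c ->
  maker_after_star c m M (S :|: B) A.
Proof.
move=> [sMB rep cardB danger sum_ret] sS cardS starS; split=> //.
- by rewrite setUCA subUset sS.
- by have [le_SB _] := leq_card_setU S B; lia.
- move=> a /danger /= dB; have := degU S B a.
  have [_|ac] := eqVneq a c; first by have := deg_le_card S a; lia.
  by have := deg_leaf sS starS ac; lia.
- by have := @retired_degreeS B (S :|: B) A (subsetUr _ _); lia.
Qed.

Lemma maker_inv_pass c m M B A :
  maker_before_star m M B A -> maker_after_star c m M B A.
Proof.
move=> inv; rewrite -[B]set0U; apply: (maker_inv_star inv).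
- exact: sub0set.
- by rewrite cards0.
- by move=> e; rewrite inE.
Qed.

Lemma maker_inv_edge f m m' M B A w x y : maker_inv n.+1 f m M B A -> w \in A ->
  x \in component M w -> y \notin component M w ->
  [set x; y] \in free_edges M B ->
  (forall a, a \in small_active M (A :\ w) -> deg B a <= m') ->
  m' * m'.+1 <= 2 * (deg B w + retired_degree B A) ->
  maker_before_star m' ([set x; y] |: M) B (A :\ w).
Proof.
move=> [sMB rep cardB _ _] wA xC yC xyF danger sum_ret; split=> //.
- by rewrite -setUA subUset sMB andbT sub1set; case/setDP: xyF.
- exact: represents_merge.
- have cardA : #|A| = (#|A :\ w|).+1 by rewrite (cardsD1 w A) wA.
  by move: cardB; rewrite cardA; lia.
- by move=> a /(subsetP (small_activeS (subsetUr _ _) (subxx _)))/danger.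
- by rewrite retired_degreeD1.
Qed.

Hypothesis n_gt0 : 0 < n.
Hypothesis cut_large :
  forall k, small <= k -> k + small <= n -> b * n < k * (n - k).
Hypothesis degree_small : forall m, m * m.+1 <= 4 * (b * n) -> m + b + small < n.

Lemma card_Breaker_le f m M B A : maker_inv n.+1 f m M B A -> #|B| <= b * n.
Proof.
move=> [_ rep cardB _ _]; have [a aA _] := rep (Ordinal n_gt0).
have : 0 < #|A| by apply/card_gt0P; exists a.
by move/(leq_pmulr b); lia.
Qed.

Lemma maker_reply_large f m M B A : maker_inv n.+1 f m M B A ->
  small_active M A = set0 -> ~ connected_graph M ->
  exists e A', e \in free_edges M B /\ maker_before_star m (e |: M) B A'.
Proof.
move=> inv large nconn; have [_ rep _ _ sum_ret] := inv.
have is_large a : a \in A -> small <= #|component M a|.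
  by move=> aA; move/setP/(_ a): large; rewrite !inE aA => /negbT; rewrite -leqNgt.
have [u [v uv]] : exists u v, ~~ connect (adj M) u v.
  apply: NNPP => no; apply: nconn => u v; apply/negPn/negP => uv.
  by apply: no; exists u, v.
have [w wA wu] := rep u; have [a aA av] := rep v.
have aC : a \notin component M w.
  apply: contra uv; rewrite inE => wa; rewrite connect_adjC in wu.
  by apply: connect_trans wu (connect_trans wa av).
have [|x [y [xC yC xyF]]] := @free_edge_across _ M B w.
  apply: leq_ltn_trans (card_Breaker_le inv) _; apply: cut_large.
    exact: is_large.
  by apply: leq_trans (card_two_components aC); rewrite leq_add2l is_large.
exists [set x; y], (A :\ w); split=> //.
apply: (maker_inv_edge inv wA xC yC xyF); last by lia.
move=> a' /(subsetP (small_activeS (subxx M) (subsetDl A [set w]))).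
by rewrite large inE.
Qed.

Lemma maker_after_star_room c m M B A w :
  maker_after_star c m M B A -> w \in small_active M A ->
  #|component M w| + deg B w < n.
Proof.
move=> inv wA; have [sMB _ _ danger sum_ret] := inv.
have sB : B \subset complete_graph n by apply: subset_trans sMB; apply: subsetUr.
have m_small : m + b + small < n.
  apply: degree_small; apply: leq_trans sum_ret _.
  by have := retired_degree_le A sB; have := card_Breaker_le inv; clear; lia.
have deg_w : deg B w <= m.+1 + b.
  by apply: leq_trans (danger w wA) _; rewrite leq_add2l; case: (w == c); lia.
have small_w : #|component M w| < small by move: wA; rewrite inE => /andP[].
by move: small_w m_small deg_w; clear; lia.
Qed.

(* All degrees are at most [m.+1], except possibly that of the centre of the star.
   Hence a vertex [w] of maximal degree either has degree at most [m], and so have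
   all others, or it has degree at least [m.+1], and no other exceeds [m.+1]. *)
Lemma maker_reply_small c m M B A :
  maker_after_star c m M B A -> small_active M A != set0 ->
  exists e A' m', e \in free_edges M B /\ maker_before_star m' (e |: M) B A'.
Proof.
move=> inv /set0Pn[a0 a0A]; have [_ _ _ danger sum_ret] := inv.
case: (@arg_maxnP _ a0 (mem (small_active M A)) (deg B) a0A) => w /= wA w_max.
have [y yC wyF] := free_edge_at (maker_after_star_room inv wA).
have wAA : w \in A by move: wA; rewrite inE => /andP[].
have reply := maker_inv_edge inv wAA (mem_component M w) yC wyF.
exists [set w; y], (A :\ w).
have others a : a \in small_active M (A :\ w) ->
    [/\ a \in small_active M A, a != w & deg B a <= deg B w].
  rewrite inE => /andP[/setD1P[aw aA] a_small].
  have a_active : a \in small_active M A by rewrite inE aA.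
  by split=> //; apply: w_max.
have [le_m|gt_m] := leqP (deg B w) m.
  exists m; split=> //; apply: reply; last by lia.
  by move=> a /others[_ _ /leq_trans]; apply.
exists m.+1; split=> //; apply: reply; last by move: sum_ret gt_m; clear; lia.
move=> a /others[a_active aw le_w]; have := danger a a_active.
have [ac _|_] := eqVneq a c; last by rewrite addn0.
apply: leq_trans le_w _; have := danger w wA.
by rewrite -ac eq_sym (negPf aw) addn0.
Qed.

Lemma maker_reply c m M B A :
  maker_after_star c m M B A -> ~ connected_graph M ->
  exists e A' m', e \in free_edges M B /\ maker_before_star m' (e |: M) B A'.
Proof.
move=> inv nconn; have [large|] := eqVneq (small_active M A) set0.
  by have [e [A' [eF inv']]] := maker_reply_large inv large nconn; exists e, A', m.
exact: maker_reply_small inv.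
Qed.

Definition maker_ahead (s : position n) : Prop :=
  let M := maker_graph s in let B := breaker_graph s in
  exists A m, match turn s with
              | Maker => exists c, maker_after_star c m M B A
              | Breaker => maker_before_star m M B A
              end.

Lemma maker_ahead_reply s : maker_ahead s -> wins b Maker s \/
  exists2 e, e \in unclaimed s
    & maker_ahead (Position Breaker (e |: maker_graph s) (breaker_graph s)).
Proof.
set M := maker_graph s; set B := breaker_graph s => -[A [m inv]].
have [c {}inv] : exists c, maker_after_star c m M B A.
  by case: (turn s) inv => // inv; exists (Ordinal n_gt0); apply: maker_inv_pass.
have sM : M \subset complete_graph n.
  by case: inv => sMB _ _ _ _; apply: subset_trans sMB; apply: subsetUl.
have [conn|nconn] := classic (connected_graph M).
  by left; apply: connected_Maker_wins.
have [e [A' [m' [eF inv']]]] := maker_reply inv nconn.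
by right; exists e => //; exists A', m'.
Qed.

Lemma Maker_wins_of_bounds first : wins b Maker (start n first).
Proof.
apply: (@wins_strategy n b Maker maker_ahead) => [s Ps over|s Ps|s t [A [m]]|].
- have [|[e eF _]] := maker_ahead_reply Ps; first exact: wins_over.
  by rewrite over inE in eF.
- case: s Ps => [[] M B] // Ps _ no.
  have [|[e eF Pe]] := maker_ahead_reply Ps; first by left.
  by right; exists (Position Breaker (e |: M) B) => //; constructor.
- case: s => [[] M B] //= inv _ /legal_Breaker_move[S [c [sS cardS starS ->]]].
  exists A, m, c; apply: maker_inv_star => //.
  exact: subset_trans sS (subsetDl _ _).
- exists setT, 0; case: first; last exact: maker_inv_start.
  by exists (Ordinal n_gt0); apply: maker_inv_pass maker_inv_start.
Qed.

End MakerStrategy.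

Lemma Maker_wins n b first : 200 <= n -> 10 * b <= n + 9 ->
  wins b Maker (start n first).
Proof.
move=> n_large b_small.
apply: (@Maker_wins_of_bounds n b (n %/ 6)) => [|k k_ge k_le|m dang]; first lia.
- apply: (@leq_trans (n %/ 6 * (n - n %/ 6))).
    have : 6 * b < 5 * (n %/ 6) by lia.
    have : 5 * n <= 6 * (n - n %/ 6) by lia.
    by move: (n %/ 6) (n - n %/ 6) => s r; nia.
  have : n = k + (n - k) by lia.
  by nia.
- rewrite ltnNge; apply/negP => large.
  have : 7 * n <= 10 * m by lia.
  by nia.
Qed.

Section BreakerStrategy.
Variables n b : nat.
Hypothesis n_gt1 : 1 < n.
Implicit Types (M B S : graph n) (u v w c : 'I_n) (e : {set 'I_n}).
Implicit Types W P Q : {set 'I_n}.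

Definition untouched M v : Prop := forall e, e \in M -> v \notin e.

Lemma untouchedU1 M e v : untouched M v -> v \notin e -> untouched (e |: M) v.
Proof. by move=> unt ve f /setU1P[->|/unt]. Qed.

Lemma untouched_won (s : position n) v :
  untouched (maker_graph s) v -> won_by Breaker s.
Proof.
move=> unt /= -[T [_ conn _] sT].
have /card_gt0P[y] : 0 < #|[set~ v]| by rewrite cardsC1 card_ord -subn1 subn_gt0.
rewrite !inE => yv.
have /connectP[[|z p] /= path_p last_p] := conn v y.
  by rewrite last_p eqxx in yv.
case/andP: path_p => /andP[_ vzT] _.
by have := unt _ (subsetP sT _ vzT); rewrite !inE eqxx.
Qed.

Lemma isolated_Breaker_wins M B v p :
  untouched M v -> deg (free_edges M B) v = 0 -> wins b Breaker (Position p M B).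
Proof.
move=> unt iso; pose I (s : position n) :=
  untouched (maker_graph s) v /\ deg (unclaimed s) v = 0.
apply: (@wins_invariant n b Breaker I) => // {M B p unt iso} [s t [unt iso] st|].
  have shrink M B M' B' : M \subset M' -> B \subset B' ->
      deg (free_edges M B) v = 0 -> deg (free_edges M' B') v = 0.
    by move=> sM sB d0; apply/eqP; rewrite -leqn0 -d0 degS ?free_edgesS.
  case: st unt iso => [M B e eF | M B S c _ _ _ _] /= unt iso; split=> //=.
  - apply: untouchedU1 => //; apply: contra_eqN iso => ve.
    by rewrite -lt0n; apply/card_gt0P; exists e; rewrite inE eF.
  - by apply: shrink iso; rewrite ?subsetUr.
  - by apply: shrink iso; rewrite ?subsetUr.
by move=> s [unt _]; apply: untouched_won unt.
Qed.

Lemma Breaker_wins_by_star M B S c v :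
  untouched M v -> S \subset free_edges M B -> #|S| <= b -> star S c ->
  wins b Breaker (Position Maker M (S :|: B)) ->
  wins b Breaker (Position Breaker M B).
Proof.
move=> unt sS cardS starS win; have [over|no] := game_over_em (Position Breaker M B).
  by apply: WinsOver => //; apply: (@untouched_won _ v).
exact: WinsOwnTurn (BreakerMove no sS cardS starS) win.
Qed.

Lemma Breaker_wins_replies M B v : untouched M v ->
  (forall e, e \in free_edges M B -> wins b Breaker (Position Breaker (e |: M) B)) ->
  wins b Breaker (Position Maker M B).
Proof.
move=> unt win; have [over|no] := game_over_em (Position Maker M B).
  by apply: WinsOver => //; apply: (@untouched_won _ v).
by apply: WinsOppTurn => // t /legal_Maker_move[e eF ->]; apply: win.
Qed.

Definition threatened M B v : Prop :=
  untouched M v /\ deg (free_edges M B) v <= b.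

Lemma threatened_Breaker_wins M B v :
  threatened M B v -> wins b Breaker (Position Breaker M B).
Proof.
move=> [unt le_b]; set S := edges_at (free_edges M B) v.
have starS : star S v by move=> e; rewrite inE => /andP[].
apply: (Breaker_wins_by_star unt _ le_b starS); first exact: edges_at_sub.
apply: isolated_Breaker_wins unt _; apply/eqP; rewrite cards_eq0 -subset0.
apply/subsetP=> e; rewrite !inE.
by case: (e \in M); case: (e \in B); case: (v \in e); case: (#|e| == 2).
Qed.

Lemma Breaker_wins_by_threat M B W u : threatened M B u -> u \notin W ->
  spokes u W \subset B ->
  (forall e, [disjoint W & e] -> wins b Breaker (Position Breaker (e |: M) B)) ->
  wins b Breaker (Position Maker M B).
Proof.
move=> [unt le_b] uW sB win; apply: (Breaker_wins_replies unt) => e eF.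
have [ue|ue] := boolP (u \in e); last first.
  apply: (@threatened_Breaker_wins _ _ u); split; first exact: untouchedU1.
  by apply: leq_trans le_b; rewrite degS ?free_edgesS ?subsetUr.
apply: win; apply/pred0P=> v /=; apply/negP=> /andP[vW ve].
have uv : u != v by apply: contraNneq uW => ->.
have [eK /negP[]] := setDP eF.
apply/setUP; right; rewrite (edgeE eK ue ve uv).
exact/(subsetP sB)/imset_f.
Qed.

(* Breaker's reserve: he can still claim any star centred in [W] with leaves in
   [W], and the vertices there have degree at least [g]. *)
Definition reserve (g : 'I_n -> nat) M B W : Prop :=
  [/\ B \subset complete_graph n,
      forall v, v \in W -> untouched M v,
      forall u v, u \in W -> v \in W -> [set u; v] \notin B
    & forall v, v \in W -> g v <= deg B v].

Lemma reserveS g g' M B W W' : reserve g M B W -> W' \subset W ->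
  (forall v, v \in W' -> g' v <= g v) -> reserve g' M B W'.
Proof.
move=> [sB unt indep lev] /subsetP sW leg; split=> //.
- by move=> v /sW/unt.
- by move=> u v /sW uW /sW vW; apply: indep.
- by move=> v vW; apply: leq_trans (leg v vW) (lev v (sW v vW)).
Qed.

Lemma reserve_edge g M B W e :
  reserve g M B W -> [disjoint W & e] -> reserve g (e |: M) B W.
Proof.
move=> [sB unt indep lev] dis; split=> // v vW.
by apply: untouchedU1; [apply: unt | rewrite (disjointFr dis vW)].
Qed.

Lemma reserve_spokes g M B W c : reserve g M B W -> c \in W ->
  spokes c (W :\ c) \subset free_edges M B.
Proof.
move=> [_ unt indep _] cW; apply/subsetP=> _ /imsetP[v /setD1P[vc vW] ->].
rewrite inE edge_complete 1?eq_sym // andbT inE negb_or indep // andbT.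
by apply: contraL (set21 c v) => /(unt c cW).
Qed.

Lemma reserve_spokes_edge g M B W Q c e : reserve g M B W -> c \in W ->
  Q \subset W :\ c -> [disjoint Q & e] ->
  spokes c Q \subset free_edges (e |: M) B.
Proof.
move=> inv cW /subsetP sQ dis; apply/subsetP=> _ /imsetP[q qQ ->].
have : [set c; q] \in free_edges M B.
  exact/(subsetP (reserve_spokes inv cW))/imset_f/sQ.
rewrite !inE !negb_or => /andP[/andP[-> ->] ->]; rewrite !andbT.
by apply: contraFneq (disjointFr dis qQ) => <-; apply: set22.
Qed.

Lemma reserve_star g M B W S c Q : reserve g M B W ->
  S \subset free_edges M B -> star S c -> c \notin W -> spokes c Q \subset S ->
  reserve (fun v => g v + (v \in Q)) M (S :|: B) W.
Proof.
move=> [sB unt indep lev] sS starS cW /subsetP sQ; split=> //.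
- by rewrite subUset sB andbT; apply: subset_trans sS (subsetDl _ _).
- move=> u v uW vW; rewrite inE negb_or indep // andbT.
  by apply: contra cW => /starS; rewrite !inE => /orP[]/eqP->.
- move=> v vW; rewrite degU_disjoint ?(disjointWl sS) ?free_edges_disjoint //.
  rewrite addnC leq_add ?lev //; case vQ: (v \in Q) => //.
  apply/card_gt0P; exists [set c; v].
  by apply/setIdP; split; [apply/sQ/imset_f | apply: set22].
Qed.

Lemma reserve_full_star g M B W u : reserve g M B W -> u \in W ->
  #|W :\ u| <= b <= deg (free_edges M B) u ->
  exists S, [/\ spokes u (W :\ u) \subset S, S \subset free_edges M B,
               star S u & #|S| = b].
Proof.
move=> inv uW /andP[leWu le_deg].
have spokes_at : spokes u (W :\ u) \subset edges_at (free_edges M B) u.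
  rewrite /edges_at setIdE subsetI (reserve_spokes inv uW).
  by apply/subsetP=> e /star_spokes; rewrite inE.
have [|S [spS sS cardS]] := exists_set_between (k := b) spokes_at.
  by rewrite card_spokes leWu.
exists S; split=> //; first exact: subset_trans sS (edges_at_sub _ _).
by move=> e /(subsetP sS); rewrite inE => /andP[].
Qed.

Definition Breaker_wins_reserve g W : Prop :=
  forall M B, reserve g M B W -> wins b Breaker (Position Maker M B).

(* The star at [u] leaves Maker no other choice than an edge from [u] to the
   outside of [W], so only [u] drops out of [W] while the rest gains a degree. *)
Lemma Breaker_finishes k d M B W : reserve (fun=> d) M B W -> #|W| = k.+1 ->
  k <= b -> n <= d + k.+1 + b -> n.-1 <= d + b + b ->
  wins b Breaker (Position Breaker M B).
Proof.
elim: k d M B W => [|k IH] d M B W inv cardW kb dkb d2b;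
  have [sB unt _ lev] := inv;
  have /card_gt0P[u uW] : 0 < #|W| by rewrite cardW.
  apply: (@threatened_Breaker_wins _ _ u); split; first exact: unt.
  by move: (deg_free_edges M u sB) (lev u uW) dkb; clear; lia.
have [le_b|gt_b] := leqP (deg (free_edges M B) u) b.
  by apply: (@threatened_Breaker_wins _ _ u); split; first exact: unt.
have cardWu : #|W :\ u| = k.+1 by move: cardW; rewrite (cardsD1 u) uW => -[].
have [|S [spS sF starS cardS]] := reserve_full_star inv uW.
  by rewrite cardWu kb ltnW.
have uWu : u \notin W :\ u by rewrite !inE eqxx.
have invS : reserve (fun v => d + (v \in W :\ u)) M (S :|: B) (W :\ u).
  by apply: (reserve_star _ sF starS uWu spS); apply: reserveS inv (subsetDl _ _) _.
apply: (Breaker_wins_by_star (unt u uW) sF _ starS); first by rewrite cardS.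
apply: (Breaker_wins_by_threat _ uWu); first split.
- exact: unt.
- have [sB' _ _ _] := invS; have := deg_free_edges M u sB'.
  rewrite degU_disjoint ?(disjointWl sF) ?free_edges_disjoint //.
  by rewrite (deg_centre starS) cardS; move: (lev u uW) d2b; clear; lia.
- exact: subset_trans spS (subsetUl _ _).
move=> e dis.
apply: (IH d.+1 _ _ (W :\ u)) => //; try by move: kb dkb d2b; clear; lia.
apply: reserveS (reserve_edge invS dis) (subxx _) _ => v vW.
by rewrite vW addn1.
Qed.

(* The star is centred, if possible, at a vertex that Maker has just touched. *)
Lemma Breaker_wins_round g W : 2 < #|W| ->
  (forall W', W' \subset W -> #|W| <= #|W'| + 2 -> exists Q,
     [/\ Q \subset W', #|Q| <= b
       & Breaker_wins_reserve (fun v => g v + (v \in Q)) W']) ->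
  Breaker_wins_reserve g W.
Proof.
move=> W_gt2 feed M B inv; have W_gt0 : 0 < #|W| by apply: ltn_trans W_gt2.
have [_ unt _ _] := inv; have /card_gt0P[u uW] := W_gt0.
apply: (Breaker_wins_replies (unt u uW)) => e eF.
have e2 := card_free_edge eF.
have [|c cW] := @exists_setDU1_card _ W e W_gt0; first by rewrite e2.
set W' := W :\: (c |: e); rewrite e2 => cardW'.
have [Q [sQ cardQ win]] := feed W' (subsetDl _ _) cardW'.
have /card_gt0P[v vW'] : 0 < #|W'| by move: cardW' W_gt2; clear; lia.
have dis : [disjoint W' & e].
  by rewrite disjoint_sym disjoints_subset setCD subsetU // subsetUr orbT.
have cW' : c \notin W' by rewrite !inE eqxx.
have inv' : reserve g (e |: M) B W'.
  by apply: reserve_edge dis; apply: reserveS inv (subsetDl _ _) _.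
have sF : spokes c Q \subset free_edges (e |: M) B.
  apply: (reserve_spokes_edge inv cW); last exact: disjointWl dis.
  by apply: subset_trans sQ _; apply/setDS/subsetUl.
have [_ unt' _ _] := inv'.
apply: (Breaker_wins_by_star (unt' v vW') sF) (star_spokes (Q := Q)) _.
  by rewrite card_spokes.
by apply: win; apply: reserve_star sF (star_spokes (Q := Q)) cW' _.
Qed.

Definition Breaker_wins_at k d : Prop :=
  forall W, k <= #|W| -> Breaker_wins_reserve (fun=> d) W.

(* [#|W| * (h - l) - #|P|] degrees are missing before all of [W] reaches [h], and
   each round supplies [b] of them. *)
Lemma Breaker_wins_at_near_level k h r W P l : 0 < b <= k ->
  Breaker_wins_at k h -> P \subset W -> #|W| * (h - l) <= #|P| + b * r ->
  k + 2 * r <= #|W| -> Breaker_wins_reserve (fun v => l + (v \in P)) W.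
Proof.
case/andP=> b_gt0 le_bk win_h.
have win_full W' P' l' : P' \subset W' -> k <= #|W'| ->
    #|W'| * (h - l') <= #|P'| -> Breaker_wins_reserve (fun v => l' + (v \in P')) W'.
  move=> sPW' leW' full M B inv; apply: (win_h W' leW' M B).
  by apply: reserveS inv (subxx _) _ => v vW; apply: near_level_reached full.
elim: r W P l => [|r IH] W P l sPW missing cardW.
  by apply: win_full => //; lia.
have [full|lacking] := leqP (#|W| * (h - l)) #|P|.
  by apply: win_full => //; lia.
have hl_gt0 : 0 < h - l by case: (h - l) lacking; rewrite ?muln0.
apply: Breaker_wins_round => [|W' sW' cardW']; first by lia.
have missing' := near_level_sub sW' sPW hl_gt0 missing.
have leb : b <= #|W'| by lia.
have [Q [P' [t [sQ cardQ sP' level total]]]] := near_level_feed (subsetIr P W') leb.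
exists Q; split; rewrite ?cardQ // => M' B' inv'.
apply: (IH W' P' (l + t)) => //.
- by rewrite subnDA mulnBr leq_subLR; lia.
- by lia.
- apply: reserveS inv' (subxx _) _ => v vW'; rewrite -!addnA leq_add2l.
  by have := level v vW'; rewrite inE vW' andbT.
Qed.

Lemma Breaker_wins_at_raise k h d r m : 0 < b <= k ->
  Breaker_wins_at k h -> m * (h - d) <= b * r -> k + 2 * r <= m ->
  Breaker_wins_at m d.
Proof.
move=> bk win_h pot le_m W leW M B inv.
have [|W' [_ sW' cardW']] := exists_set_between (sub0set W) (k := m).
  by rewrite cards0.
apply: (@Breaker_wins_at_near_level k h r W' set0 d); rewrite ?cards0 ?cardW' //.
  exact: sub0set.
by apply: reserveS inv sW' _ => v _; rewrite inE addn0.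
Qed.

Lemma Breaker_wins_at_finish d : n.-1 <= d + b + b -> Breaker_wins_at (b + 3) d.
Proof.
move=> d2b W leW M B inv; have [_ unt _ _] := inv.
have /card_gt0P[u uW] : 0 < #|W| by lia.
apply: (Breaker_wins_replies (unt u uW)) => e eF.
have e2 := card_free_edge eF.
have [|W' [_ sW' cardW']] := exists_set_between (sub0set (W :\: e)) (k := b.+1).
  have := subset_leq_card (subsetIr W e); have := cardsID e W.
  by rewrite cards0 e2; lia.
have [sW'W dis] : W' \subset W /\ [disjoint W' & e] by apply/andP; rewrite -subsetD.
apply: (@Breaker_finishes b d _ _ W') => //; last by lia.
by apply: reserve_edge dis; apply: reserveS inv sW'W _.
Qed.

Lemma Breaker_wins_at_start m : Breaker_wins_at m 0 -> m <= n ->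
  wins b Breaker (start n Maker).
Proof.
move=> win le_m; apply: (win setT); first by rewrite cardsT card_ord.
split; rewrite ?sub0set //; first by move=> v _ e; rewrite inE.
by move=> u v _ _; rewrite inE.
Qed.

End BreakerStrategy.

Lemma leq_mul_cross p q k h a r :
  0 < p * q -> p * k <= q * a -> q * h <= p * r -> k * h <= a * r.
Proof.
move=> pq_gt0 le_ka le_hr; have := leq_mul le_ka le_hr.
by rewrite mulnACA [leqRHS]mulnACA [q * p]mulnC leq_pmul2l.
Qed.

Lemma Breaker_wins n b first : 2000 <= n -> 3 * n < 7 * b ->
  wins b Breaker (start n first).
Proof.
move=> n_large b_large.
suff : wins b Breaker (start n Maker) by case: first => // /Breaker_wins_pass.
apply: (@wins_Breaker_mono n (3 * n %/ 7).+1); first by lia.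
set a := (3 * n %/ 7).+1; pose h := (n %/ 14).+1.
pose r1 := (7 * h %/ 3).+1; pose r2 := (14 * h %/ 9).+1.
have finish : Breaker_wins_at n a (a + 3) (h + h).
  by apply: Breaker_wins_at_finish; lia.
have middle : Breaker_wins_at n a (n - 2 * r1) h.
  apply: (@Breaker_wins_at_raise n a _ (a + 3) _ h r2 _ _ finish); try lia.
  by rewrite addnK; apply: (@leq_mul_cross 9 14) => //; lia.
have : Breaker_wins_at n a n 0.
  apply: (@Breaker_wins_at_raise n a _ (n - 2 * r1) h 0 r1) => //; try lia.
  by rewrite subn0; apply: (@leq_mul_cross 3 7) => //; lia.
by move/Breaker_wins_at_start; apply.
Qed.

Import Order.TTheory GRing.Theory Num.Theory.
Local Open Scope ring_scope.

Theorem theorem5p3 :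
  exists N : nat, forall n : nat, (N <= n)%N -> forall first : player,
    (exists b0 : nat, threshold_bias n first b0) /\
    (forall b0 : nat, threshold_bias n first b0 ->
       (1 / 10) * n%:R <= b0%:R :> rat /\ b0%:R <= (3 * n%:R) / 7 :> rat).
Proof.
exists 2000%N => n n_large first.
have winM b : (10 * b <= n + 9)%N -> wins b Maker (start n first).
  by apply: Maker_wins; apply: leq_trans n_large.
have winB b : (3 * n < 7 * b)%N -> wins b Breaker (start n first).
  exact: Breaker_wins.
split.
  by apply: (@threshold_bias_exists _ _ n); [apply: winM | apply: winB; lia].
move=> b0 thr; split.
- have b0_ge : ((n + 9) %/ 10 <= b0)%N.
    by apply: threshold_bias_ge thr; apply: winM; lia.
  by rewrite mul1r mulrC ler_pdivrMr // mulrC -natrM ler_nat; lia.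
- have b0_lt : (b0 < (3 * n %/ 7).+1)%N.
    by apply: threshold_bias_lt thr; apply: winB; lia.
  by rewrite ler_pdivlMr // mulrC -!natrM ler_nat; lia.
Qed.
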